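(* (a) If $G_1$ and $G_2$ are $Q$-cospectral regular graphs, and $H$ is a regular graph, then $G_1\dot{\vee} H$ and $G_2\dot{\vee} H$ are $Q$-cospectral. (b) If $G$ is a regular graph, and $H_1$ and $H_2$ are $Q$-cospectral graphs with $\Gamma_{Q(H_1)}(x)=\Gamma_{Q(H_2)}(x)$, then $G\dot{\vee} H_1$ and $G\dot{\vee} H_2$ are $Q$-cospectral.
   Context: All graphs are finite, simple and undirected, with at least one vertex. $Q(G)=D(G)+A(G)$ is the signless Laplacian matrix of $G$ ($D(G)$ the diagonal degree matrix, $A(G)$ the adjacency matrix); two graphs are $Q$-cospectral if their signless Laplacian matrices have the same spectrum (eigenvalues counted with multiplicity). For an $n\times n$ matrix $M$, the $M$-coronal is the rational function $\Gamma_M(x)=\mathbf{1}_n^T(xI_n-M)^{-1}\mathbf{1}_n$, where $\mathbf{1}_n$ is the all-ones column vector. The subdivision graph $\mathcal{S}(G)$ is obtained from $G$ by inserting a new vertex into every edge of $G$. For vertex-disjoint graphs $G,H$, the subdivision-vertex join $G\dot{\vee}H$ is the graph obtained from $\mathcal{S}(G)$ and $H$ by joining every vertex of $V(G)$ (the original vertices) with every vertex of $V(H)$. *)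

(* Defs.v *)
From mathcomp Require Import all_boot all_order all_algebra all_field.

Set Implicit Arguments.
Unset Strict Implicit.
Unset Printing Implicit Defensive.

Import GRing.Theory.
Local Open Scope ring_scope.

Record sgraph := SGraph {
  vertex :> finType;
  adj : rel vertex;
  adj_sym : symmetric adj;
  adj_irr : irreflexive adj;
  vertex_gt0 : (0 < #|vertex|)%N
}.

Definition deg (G : sgraph) (x : G) : nat := #|[set y | adj x y]|.

Definition regular (G : sgraph) : Prop :=
  exists r : nat, forall x : G, deg x = r.

(* Matrices of a graph are indexed by 'I_#|G| through the enumeration of the
   vertices. *)
Definition adj_mx (G : sgraph) : 'M[algC]_#|G| :=
  \matrix_(i, j) (adj (enum_val i) (enum_val j))%:R.

Definition deg_mx (G : sgraph) : 'M[algC]_#|G| :=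
  diag_mx (\row_i (deg (enum_val i))%:R).

Definition signless_laplacian (G : sgraph) : 'M[algC]_#|G| :=
  deg_mx G + adj_mx G.

(* The (algebraic) multiplicity of a as an eigenvalue of M, 0 if a is not an
   eigenvalue.  The matrices considered here have integer entries, so all their
   complex eigenvalues lie in algC. *)
Definition eigen_mult n (M : 'M[algC]_n) (a : algC) : nat :=
  mup a (char_poly M).

Definition same_spectrum m n (M : 'M[algC]_m) (N : 'M[algC]_n) : Prop :=
  forall a : algC, eigen_mult M a = eigen_mult N a.

Definition Qcospectral (G H : sgraph) : Prop :=
  same_spectrum (signless_laplacian G) (signless_laplacian H).

(* x I_n - M over the field of rational functions in x; char_poly_mx M is
   'X%:M - map_mx polyC M. *)
Definition resolvent_mx n (M : 'M[algC]_n) : 'M[{fraction {poly algC}}]_n :=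
  map_mx (@tofrac {poly algC}) (char_poly_mx M).

(* The inverse in coronal is a genuine one. *)
Lemma resolvent_mx_unit n (M : 'M[algC]_n) : resolvent_mx M \in unitmx.
Proof.
rewrite unitmxE det_map_mx unitfE tofrac_eq0.
exact: monic_neq0 (char_poly_monic M).
Qed.

Definition coronal n (M : 'M[algC]_n) : {fraction {poly algC}} :=
  ((const_mx 1 : 'cV_n)^T *m invmx (resolvent_mx M) *m (const_mx 1 : 'cV_n))
    0 0.

Definition edges (G : sgraph) : {set {set G}} :=
  [set [set p.1; p.2] | p : G * G & adj p.1 p.2].

Definition edge (G : sgraph) : finType := {e : {set G} | e \in edges G}.

(* The vertex inserted into an edge e is e itself. *)
Definition subdiv_adj (G : sgraph) : rel (G + edge G)%type :=
  fun u v => match u, v with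
  | inl x, inr e => x \in val e
  | inr e, inl x => x \in val e
  | _, _ => false
  end.

Lemma subdiv_adj_sym (G : sgraph) : symmetric (@subdiv_adj G).
Proof. by move=> [x|e] [y|f]. Qed.

Lemma subdiv_adj_irr (G : sgraph) : irreflexive (@subdiv_adj G).
Proof. by case. Qed.

Lemma subdiv_gt0 (G : sgraph) : (0 < #|{: G + edge G}|)%N.
Proof. by rewrite card_sum addn_gt0 vertex_gt0. Qed.

Definition subdivision (G : sgraph) : sgraph :=
  SGraph (@subdiv_adj_sym G) (@subdiv_adj_irr G) (subdiv_gt0 G).

Definition is_original (G : sgraph) (u : subdivision G) : bool :=
  if u is inl _ then true else false.

Definition sv_join_adj (G H : sgraph) : rel (subdivision G + H)%type :=
  fun u v => match u, v with
  | inl s, inl t => adj s t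
  | inr x, inr y => adj x y
  | inl s, inr _ => is_original s
  | inr _, inl s => is_original s
  end.

Lemma sv_join_adj_sym (G H : sgraph) : symmetric (@sv_join_adj G H).
Proof. by move=> [s|x] [t|y] //; apply: adj_sym. Qed.

Lemma sv_join_adj_irr (G H : sgraph) : irreflexive (@sv_join_adj G H).
Proof. by move=> [s|x]; apply: adj_irr. Qed.

Lemma sv_join_gt0 (G H : sgraph) : (0 < #|{: subdivision G + H}|)%N.
Proof. by rewrite card_sum addn_gt0 vertex_gt0. Qed.

Definition subdiv_vertex_join (G H : sgraph) : sgraph :=
  SGraph (@sv_join_adj_sym G H) (@sv_join_adj_irr G H) (sv_join_gt0 G H).

(* Main.v *)
Require Import Defs.
From mathcomp Require Import all_boot all_order all_algebra all_field.
From mathcomp Require Import perm ring.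

(* Let G be r-regular with n vertices and m edges, let B be its vertex-edge
   incidence matrix and J an all-ones matrix.  In the vertex order V(G), E(G),
   V(H), the signless Laplacian of the join is
       [ (r + |H|) I    B     J          ]
       [ B^T           2 I    0          ]
       [ J^T            0    n I + Q(H)  ]
   and B B^T = Q(G).  Taking the Schur complement of the last two blocks, its
   characteristic polynomial at x is
     (x - 2)^m * chi_{Q(H)}(x - n)
       * det((x - |H| - r) I - Q(G) / (x - 2) - Gamma_{Q(H)}(x - n) J),
   which gives (b).  As Q(G) 1 = 2 r 1, the last determinant depends on G only
   through n, r and chi_{Q(G)}; the spectrum of Q(G) determines n, its trace
   n r = 2 m, hence r and m, which gives (a). *)

Set Implicit Arguments.
Unset Strict Implicit.
Unset Printing Implicit Defensive.

Import GRing.Theory Num.Theory.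
Local Open Scope ring_scope.
Local Notation "x %:F" := (tofrac x).

(** * Determinant identities *)

Lemma det_mxsub_bij (R : comPzRingType) p q (h : 'I_p -> 'I_q) (A : 'M[R]_q) :
  bijective h -> \det (mxsub h h A) = \det A.
Proof.
move=> hbij; have eq_pq : p = q by have := bij_eq_card hbij; rewrite !card_ord.
subst q; pose s := perm (bij_inj hbij).
have -> : mxsub h h A = col_perm s (row_perm s A).
  by apply/matrixP => i j; rewrite !mxE !permE.
(* Rows and columns undergo the same permutation, so the two permutation matrices are mutually
   inverse and their determinants cancel. *)
rewrite col_permE row_permE !det_mulmx mulrAC -det_mulmx -perm_mxM.
by rewrite mulgV perm_mx1 det1 mul1r.
Qed.

Lemma det_block_schur (R : comUnitRingType) m n (A : 'M[R]_m) B C (D : 'M_n) :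
  D \in unitmx ->
  \det (block_mx A B C D) = \det D * \det (A - B *m invmx D *m C).
Proof.
move=> Du.
have -> : block_mx A B C D =
    block_mx (A - B *m invmx D *m C) (B *m invmx D) 0 1%:M *m
    block_mx 1%:M 0 C D.
  by rewrite mulmx_block !mulmx1 !mulmx0 !mul1mx !add0r subrK mulmxKV.
by rewrite det_mulmx det_ublock det_lblock !det1 mulr1 mul1r mulrC.
Qed.

(** Eliminating either diagonal block of [block_mx 1 v u 1] computes the same determinant: one Schur
    complement has size n, the other size 1. *)
Lemma det_sub_mul_col_row (R : comUnitRingType) n (u : 'cV[R]_n) (v : 'rV_n) :
  \det (1%:M - u *m v) = 1 - (v *m u) 0 0.
Proof.
have := @det_block_schur R _ _ 1%:M v u 1%:M (unitmx1 _ _).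
rewrite invmx1 det1 mul1r mulmx1.
have -> : block_mx 1%:M v u 1%:M =
    block_mx 1%:M 0 u 1%:M *m block_mx 1%:M v 0 (1%:M - u *m v).
  by rewrite mulmx_block !mulmx1 !mulmx0 !mul0mx !mul1mx !addr0 addrC subrK.
rewrite det_mulmx det_lblock det_ublock !det1 !mul1r => ->.
by rewrite det_mx11 !mxE eqxx.
Qed.

(* With J the all-ones matrix, [M J = mu J], so [M - c J = M (1 - (c / mu) J)]:
   no invertibility of M is needed. *)
Lemma det_sub_const_mx (F : fieldType) n (M : 'M[F]_n) (mu c : F) :
  mu != 0 -> M *m const_mx 1 = mu *: (const_mx 1 : 'cV_n) ->
  \det (M - c *: const_mx 1) = \det M * (1 - c / mu * n%:R).
Proof.
move=> mu0 M1; pose u : 'cV[F]_n := const_mx 1; pose v : 'rV[F]_n := const_mx 1.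
have uv : u *m v = const_mx 1.
  by apply/matrixP => i j; rewrite !mxE big_ord1 !mxE mulr1.
have -> : M - c *: const_mx 1 = M *m (1%:M - ((c / mu) *: u) *m v).
  rewrite mulmxBr mulmx1 mulmxA -scalemxAr M1 scalerA divfK //.
  by rewrite -scalemxAl uv.
rewrite det_mulmx det_sub_mul_col_row -scalemxAr !mxE.
under eq_bigr do rewrite !mxE mulr1.
by rewrite sumr_const card_ord.
Qed.

(** * Characteristic polynomials, spectra and coronals, compared through values *)

Lemma horner_char_poly (R : comNzRingType) n (M : 'M[R]_n) a :
  (char_poly M).[a] = \det (a%:M - M).
Proof.
rewrite -horner_evalE -det_map_mx; congr (\det _).
apply/matrixP => i j; rewrite !mxE /= /horner_eval.
by rewrite hornerD hornerN hornerMn hornerX hornerC.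
Qed.

(** Over a closed field both polynomials split, and equal multiplicities make their root sequences
    permutations of each other. *)
Lemma eq_monic_mup (F : closedFieldType) (p q : {poly F}) :
  p \is monic -> q \is monic -> (forall a, mup a p = mup a q) -> p = q.
Proof.
move=> /monicP pm /monicP qm.
have [[r def_p] [s def_q]] := (closed_field_poly_normal p, closed_field_poly_normal q).
rewrite def_p def_q pm qm !scale1r => eq_mu.
apply: perm_big; apply/allP => a _ /=.
by have := eq_mu a; rewrite !mu_prod_XsubC => ->.
Qed.

(** A closed field is infinite, so [(p - q) * d], which vanishes at every point, is zero. The roots
    of [d] are points where a formula for the values may break down. *)
Lemma eq_poly_generic (F : closedFieldType) (d p q : {poly F}) :
  d != 0 -> (forall a, d.[a] != 0 -> p.[a] = q.[a]) -> p = q.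
Proof.
move=> d0 eq_pq; apply/eqP; rewrite -subr_eq0.
suff: (p - q) * d == 0 by rewrite mulf_eq0 (negPf d0) orbF.
apply: contraT => /closed_nonrootP [a]; rewrite rootE hornerM hornerD hornerN.
have [->|/eq_pq ->] := eqVneq d.[a] 0; first by rewrite mulr0 eqxx.
by rewrite subrr mul0r eqxx.
Qed.

Lemma same_spectrumP m n (M : 'M[algC]_m) (N : 'M[algC]_n) :
  same_spectrum M N <-> char_poly M = char_poly N.
Proof.
split=> [eqMN|eqMN a]; last by rewrite /eigen_mult eqMN.
exact: eq_monic_mup (char_poly_monic M) (char_poly_monic N) eqMN.
Qed.

(* The value at a of the M-coronal, a junk value when a is an eigenvalue of M. *)
Definition coronal_at n (M : 'M[algC]_n) (a : algC) : algC :=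
  ((const_mx 1 : 'cV_n)^T *m invmx (a%:M - M) *m (const_mx 1 : 'cV_n)) 0 0.

(** Numerator of the coronal over the denominator [char_poly M], by the adjugate formula. Being a
    polynomial, it links the rational function to its values. *)
Definition coronal_num n (M : 'M[algC]_n) : {poly algC} :=
  ((const_mx 1 : 'cV_n)^T *m \adj (char_poly_mx M) *m (const_mx 1 : 'cV_n)) 0 0.

Lemma rmorph_entry_sum (aR rR : pzRingType) (f : {rmorphism aR -> rR}) n
    (A : 'M[aR]_n) :
  f (((const_mx 1 : 'cV_n)^T *m A *m (const_mx 1 : 'cV_n)) 0 0) =
  ((const_mx 1 : 'cV_n)^T *m map_mx f A *m (const_mx 1 : 'cV_n)) 0 0.
Proof.
have E : const_mx 1 = map_mx f (const_mx 1 : 'cV_n).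
  by apply/matrixP => i j; rewrite !mxE rmorph1.
by rewrite E map_trmx -!map_mxM [RHS]mxE.
Qed.

Lemma coronalE n (M : 'M[algC]_n) :
  coronal M = (char_poly M)%:F^-1 * (coronal_num M)%:F.
Proof.
rewrite /coronal /invmx resolvent_mx_unit /coronal_num rmorph_entry_sum map_mx_adj.
by rewrite -scalemxAr -scalemxAl mxE det_map_mx.
Qed.

Lemma coronal_atE n (M : 'M[algC]_n) a : (char_poly M).[a] != 0 ->
  coronal_at M a = (char_poly M).[a]^-1 * (coronal_num M).[a].
Proof.
move=> Ma; rewrite /coronal_at /invmx unitmxE unitfE -horner_char_poly Ma.
rewrite -[(coronal_num M).[a]]horner_evalE rmorph_entry_sum map_mx_adj.
rewrite -scalemxAr -scalemxAl mxE; congr (_ * (_ *m \adj _ *m _) 0 0).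
apply/matrixP => i j; rewrite !mxE /= /horner_eval.
by rewrite hornerD hornerN hornerMn hornerX hornerC.
Qed.

(** Over a common denominator, equal coronals have equal numerators as polynomials, and these can be
    evaluated at [a]. *)
Lemma eq_coronal_at m n (M : 'M[algC]_m) (N : 'M[algC]_n) a :
  char_poly M = char_poly N -> coronal M = coronal N ->
  (char_poly M).[a] != 0 -> coronal_at M a = coronal_at N a.
Proof.
move=> eq_chi; rewrite !coronalE -eq_chi.
have chi0 : (char_poly M)%:F != 0.
  by rewrite tofrac_eq0 monic_neq0 ?char_poly_monic.
move=> /(mulfI (invr_neq0 chi0)) /eqP; rewrite tofrac_eq => /eqP eq_num Ma.
by rewrite !coronal_atE -?eq_chi // eq_num.
Qed.

(** * Edge counts, the incidence matrix and degree sums *)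

Lemma edgeP (G : sgraph) (e : {set G}) :
  reflect (exists x y, adj x y /\ e = [set x; y]) (e \in edges G).
Proof.
apply: (iffP imsetP) => [[[x y] axy ->]|[x [y [axy ->]]]].
  by move: axy; rewrite inE => axy; exists x, y.
by exists (x, y); rewrite ?inE.
Qed.

Lemma card_edge_ends (G : sgraph) (e : {set G}) : e \in edges G -> #|e| = 2%N.
Proof.
case/edgeP => x [y [axy ->]]; rewrite cards2; case: eqP => // exy.
by rewrite exy adj_irr in axy.
Qed.

Lemma deg_edges (G : sgraph) (x : G) : #|[set e in edges G | x \in e]| = deg x.
Proof.
(* Neighbours y of x correspond to edges [[set x; y]]; injectivity holds because a neighbour of x
   differs from x. *)
rewrite /deg -(@card_in_imset _ _ (fun y => [set x; y])); last first.
  move=> y z; rewrite !inE => axy axz /setP /(_ y).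
  rewrite !inE eqxx orbT => /esym /orP [] /eqP // exy.
  by rewrite exy adj_irr in axy.
apply: eq_card => e; rewrite inE; apply/andP/imsetP => [[/edgeP]|[y]].
  move=> [a [b [aab ->]]]; rewrite !inE => /orP [] /eqP ->.
    by exists b; rewrite ?inE.
  by exists a; rewrite ?inE 1?adj_sym // setUC.
by rewrite inE => axy ->; rewrite !inE eqxx; split=> //; apply/edgeP; exists x, y.
Qed.

(** An edge has exactly two elements, so [[set x; y]] is the only candidate. *)
Lemma adj_edges (G : sgraph) (x y : G) : x != y ->
  #|[set e in edges G | (x \in e) && (y \in e)]| = adj x y.
Proof.
move=> nxy; have edge_xy : ([set x; y] \in edges G) = adj x y.
  apply/edgeP/idP => [[a [b [aab /setP eqab]]]|axy]; last by exists x, y.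
  have := eqab x; have := eqab y; rewrite !inE !eqxx orbT.
  move=> /esym /orP [] /eqP ey /esym /orP [] /eqP ex; move: nxy aab;
    by rewrite ex ey ?eqxx // adj_sym.
have -> : [set e in edges G | (x \in e) && (y \in e)] =
    [set e in edges G | e == [set x; y]].
  apply/setP => e; rewrite !inE; apply: andb_id2l => eE.
  apply/andP/eqP => [[xe ye]|->]; last by rewrite !inE !eqxx orbT.
  apply/esym/eqP; rewrite eqEcard (card_edge_ends eE) cards2 nxy andbT.
  by apply/subsetP => z; rewrite !inE => /orP [] /eqP ->.
rewrite -edge_xy -sum1dep_card big_mkcondl (big_pred1 [set x; y]) /=.
  by case: (_ \in _).
by move=> e.
Qed.

Lemma sum_edges (G : sgraph) (P : pred {set G}) :
  (\sum_(e : edge G) P (val e) = #|[set e in edges G | P e]|)%N.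
Proof.
rewrite -(big_sub (fun e => e \in edges G) (fun e => P e : nat)).
by rewrite -sum1dep_card big_mkcondr; apply: eq_bigr => e _; case: (P e).
Qed.

Definition incidence (G : sgraph) : 'M[algC]_(#|G|, #|edge G|) :=
  \matrix_(i, k) (enum_val i \in val (enum_val k : edge G))%:R.

(** Addressing entries by vertices makes them independent of the enumeration, which matters for the
    reordered join. *)
Definition laplacian_entry (G : sgraph) (x y : G) : algC :=
  (deg x)%:R *+ (x == y) + (adj x y)%:R.

Lemma signless_laplacianE (G : sgraph) i j :
  signless_laplacian G i j = laplacian_entry (enum_val i) (enum_val j).
Proof. by rewrite !mxE /laplacian_entry (inj_eq enum_val_inj). Qed.

(** The entry at (x, y) counts the edges containing both x and y: the degree on the diagonal, the
    adjacency off it. *)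
Lemma incidence_mul_tr (G : sgraph) :
  incidence G *m (incidence G)^T = signless_laplacian G.
Proof.
apply/matrixP => i j; rewrite signless_laplacianE mxE /laplacian_entry.
set x := enum_val i; set y := enum_val j.
transitivity ((\sum_(e : edge G) ((x \in val e) && (y \in val e) : nat))%:R : algC).
  rewrite natr_sum (reindex _ (onW_bij _ (@enum_val_bij (edge G)))) /=.
  by apply: eq_bigr => k _; rewrite !mxE -natrM mulnb.
rewrite (sum_edges (fun e => (x \in e) && (y \in e))).
have [<-|nxy] := eqVneq x y; last by rewrite adj_edges // add0r.
rewrite adj_irr addr0 -deg_edges; congr (_%:R); apply: eq_card => e.
by rewrite !inE andbb.
Qed.

Lemma degE (G : sgraph) (x : G) : deg x = (\sum_y (adj x y : nat))%N.
Proof. by rewrite /deg -sum1dep_card big_mkcond; apply: eq_bigr => y _; case: adj. Qed.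

Lemma trace_signless_laplacian (G : sgraph) :
  \tr (signless_laplacian G) = (\sum_(x : G) deg x)%:R.
Proof.
rewrite natr_sum (reindex _ (onW_bij _ (@enum_val_bij G))) /=.
apply: eq_bigr => i _.
by rewrite signless_laplacianE /laplacian_entry eqxx adj_irr addr0.
Qed.

Lemma handshake (G : sgraph) : (\sum_(x : G) deg x = #|edge G| * 2)%N.
Proof.
rewrite -sum_nat_const.
under eq_bigr do rewrite -deg_edges -sum_edges.
rewrite exchange_big /=; apply: eq_bigr => e _.
rewrite -(card_edge_ends (valP e)) -sum1_card [RHS]big_mkcond.
by apply: eq_bigr => x _; case: (x \in _).
Qed.

(** * Degrees in the join and its block matrix *)

Lemma deg_join_vertex (G H : sgraph) (x : G) :
  @deg (subdiv_vertex_join G H) (inl (inl x)) = (deg x + #|H|)%N.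
Proof.
rewrite degE !big_sumType /= [X in (X + _ + _)%N]big1 // add0n.
by rewrite (sum_edges (fun e => x \in e)) deg_edges sum1_card.
Qed.

Lemma deg_join_edge (G H : sgraph) (e : edge G) :
  @deg (subdiv_vertex_join G H) (inl (inr e)) = 2%N.
Proof.
rewrite degE !big_sumType /= [X in (_ + X + _)%N]big1 // addn0.
rewrite [X in (_ + X)%N]big1 // addn0 -(card_edge_ends (valP e)) -sum1_card.
by rewrite [RHS]big_mkcond; apply: eq_bigr => x _; case: (x \in _).
Qed.

Lemma deg_join_right (G H : sgraph) (y : H) :
  @deg (subdiv_vertex_join G H) (inr y) = (#|G| + deg y)%N.
Proof.
rewrite degE !big_sumType /= sum1_card [X in (_ + X + _)%N]big1 // addn0.
by rewrite -degE.
Qed.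

(* The vertices of the join, ordered as V(G), then E(G), then V(H). *)
Definition join_vertex (G H : sgraph)
    (i : 'I_(#|G| + (#|edge G| + #|H|))) : subdiv_vertex_join G H :=
  match split i with
  | inl j => inl (inl (enum_val j))
  | inr j =>
    match split j with
    | inl k => inl (inr (enum_val k))
    | inr k => inr (enum_val k)
    end
  end.

Definition join_rank (G H : sgraph) (u : subdiv_vertex_join G H) :
    'I_(#|G| + (#|edge G| + #|H|)) :=
  match u with
  | inl (inl x) => lshift _ (enum_rank x)
  | inl (inr e) => rshift _ (lshift _ (enum_rank (e : edge G)))
  | inr y => rshift _ (rshift _ (enum_rank y))
  end.

Lemma join_vertexK (G H : sgraph) : cancel (@join_vertex G H) (@join_rank G H).
Proof.
move=> i; rewrite /join_vertex; case: split_ordP => j ->.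
  by rewrite /join_rank enum_valK.
by case: split_ordP => k ->; rewrite /join_rank enum_valK.
Qed.

Lemma join_rankK (G H : sgraph) : cancel (@join_rank G H) (@join_vertex G H).
Proof.
rewrite /join_vertex; case=> [[x|e]|y] /=; case: split_ordP => j //.
- by move/lshift_inj => <-; rewrite enum_rankK.
- by move/eqP; rewrite eq_lrshift.
- by move/eqP; rewrite eq_rlshift.
- move/rshift_inj <-; case: split_ordP => k.
    by move/lshift_inj => <-; rewrite enum_rankK.
  by move/eqP; rewrite eq_lrshift.
- by move/eqP; rewrite eq_rlshift.
- move/rshift_inj <-; case: split_ordP => k.
    by move/eqP; rewrite eq_rlshift.
  by move/rshift_inj => <-; rewrite enum_rankK.
Qed.

Lemma join_vertex_left (G H : sgraph) i :
  @join_vertex G H (lshift _ i) = inl (inl (enum_val i)).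
Proof. by rewrite -[RHS]join_rankK /= enum_valK. Qed.

Lemma join_vertex_edge (G H : sgraph) k :
  @join_vertex G H (rshift _ (lshift _ k)) = inl (inr (enum_val k)).
Proof. by rewrite -[RHS]join_rankK /= enum_valK. Qed.

Lemma join_vertex_right (G H : sgraph) k :
  @join_vertex G H (rshift _ (rshift _ k)) = inr (enum_val k).
Proof. by rewrite -[RHS]join_rankK /= enum_valK. Qed.

Definition join_vertexE :=
  (join_vertex_left, join_vertex_edge, join_vertex_right).

Lemma char_matrix_join (G H : sgraph) (a : algC) :
  let h := enum_rank \o @join_vertex G H in
  mxsub h h (a%:M - signless_laplacian (subdiv_vertex_join G H)) =
  block_mx ((a - #|H|%:R)%:M - deg_mx G) (row_mx (- incidence G) (const_mx (-1)))
    (col_mx (- (incidence G)^T) (const_mx (-1)))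
    (block_mx (a - 2)%:M 0 0 ((a - #|G|%:R)%:M - signless_laplacian H)).
Proof.
move=> h; apply/matrixP => i j.
transitivity (a *+ (i == j) - ((deg (join_vertex i))%:R *+ (i == j) +
    (adj (join_vertex i) (join_vertex j))%:R)).
  rewrite mxE [LHS]mxE mxE [X in _ + X]mxE signless_laplacianE !enum_rankK.
  rewrite (inj_eq enum_rank_inj) /laplacian_entry.
  by rewrite (inj_eq (can_inj (@join_vertexK G H))).
(* Nine blocks: the off-diagonal ones follow by evaluating [adj], and the three diagonal ones are
   left for degree arithmetic. *)
case: (split_ordP i) => {}i ->; [|case: (split_ordP i) => {}i ->];
  (case: (split_ordP j) => {}j ->; [|case: (split_ordP j) => {}j ->]);
  rewrite !(join_vertexE, block_mxEul, block_mxEur, block_mxEdl, block_mxEdr,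
    row_mxEl, row_mxEr, col_mxEu, col_mxEd)
    ?(deg_join_vertex, deg_join_edge, deg_join_right)
    ?(eq_lshift, eq_rshift, eq_lrshift, eq_rlshift) /= !mxE
    ?(mulr0n, add0r, addr0, sub0r, subr0, oppr0) //.
- by rewrite natrD; case: (i == j) => /=; ring.
- by case: (i == j) => /=; ring.
- by rewrite natrD; case: (i == j) => /=; ring.
Qed.

(** * The characteristic polynomial of the join *)

Lemma const_mul_const m n (M : 'M[algC]_n) :
  (const_mx 1 : 'M_(m, n)) *m M *m (const_mx 1 : 'M_(n, m)) =
  (((const_mx 1 : 'cV_n)^T *m M *m (const_mx 1 : 'cV_n)) 0 0) *: const_mx 1.
Proof.
apply/matrixP => i j; rewrite !mxE mulr1; apply: eq_bigr => k _.
by rewrite !mxE; congr (_ * _); apply: eq_bigr => l _; rewrite !mxE.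
Qed.

(** Each row sum receives [r] twice, from the diagonal entry and from the adjacencies. *)
Lemma regular_signless_laplacian (G : sgraph) r : (forall x : G, deg x = r) ->
  signless_laplacian G *m const_mx 1 = (2 * r)%:R *: (const_mx 1 : 'cV_#|G|).
Proof.
move=> reg; apply/matrixP => i j; rewrite !mxE mulr1.
transitivity (\sum_k ((r%:R : algC) *+ (i == k) + (adj (enum_val i) (enum_val k))%:R)).
  by apply: eq_bigr => k _; rewrite signless_laplacianE /laplacian_entry mxE mulr1
    reg (inj_eq enum_val_inj).
rewrite big_split /= mulSn mul1n natrD; congr (_ + _).
  by rewrite (bigD1 i) //= eqxx big1 ?addr0 // => k /negPf; rewrite eq_sym => ->.
rewrite -natr_sum -(reg (enum_val i)) degE.
by rewrite (reindex _ (onW_bij _ (@enum_val_bij G))).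
Qed.

(** Here [H] enters only through its order, its characteristic polynomial and its coronal value,
    which is what (b) compares. *)
Lemma char_poly_join (G H : sgraph) r a (b := a - #|G|%:R) :
  (forall x : G, deg x = r) -> a != 2 ->
  (char_poly (signless_laplacian H)).[b] != 0 ->
  (char_poly (signless_laplacian (subdiv_vertex_join G H))).[a] =
  (a - 2) ^+ #|edge G| * (char_poly (signless_laplacian H)).[b] *
  \det ((a - #|H|%:R - r%:R)%:M - (a - 2)^-1 *: signless_laplacian G
        - coronal_at (signless_laplacian H) b *: const_mx 1).
Proof.
move=> reg a2 b0; rewrite horner_char_poly.
have hbij : bijective (enum_rank \o @join_vertex G H).
  apply: bij_comp; first exact: enum_rank_bij.
  by exists (@join_rank G H); [exact: join_vertexK | exact: join_rankK].
rewrite -(det_mxsub_bij _ hbij) char_matrix_join -/b.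
set D1 := (a - 2)%:M; set D2 := b%:M - _.
have D1u : D1 \in unitmx by rewrite unitmxE det_scalar unitrX // unitfE subr_eq0.
have D2u : D2 \in unitmx by rewrite unitmxE -horner_char_poly unitfE.
have Du : block_mx D1 0 0 D2 \in unitmx.
  by rewrite unitmxE det_ublock unitrM -!unitmxE D1u.
rewrite det_block_schur // det_ublock det_scalar -horner_char_poly.
(* The lower right block is block diagonal, so the correction splits: the edges give [(a - 2)^-1]
   times Q(G), and V(H), between all-ones blocks, gives the coronal value times J. *)
rewrite invmx_block_diag // mul_row_block !mulmx0 addr0 add0r mul_row_col.
congr (_ * \det _).
rewrite invmx_scalar !mul_mx_scalar -scalemxAl mulNmx mulmxN opprK incidence_mul_tr.
have -> : (const_mx (-1) : 'M[algC]_(#|G|, #|H|)) = - const_mx 1.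
  by apply/matrixP => i j; rewrite !mxE.
have -> : (const_mx (-1) : 'M[algC]_(#|H|, #|G|)) = - const_mx 1.
  by apply/matrixP => i j; rewrite !mxE.
rewrite !mulNmx mulmxN opprK const_mul_const -/(coronal_at _ _) opprD addrA.
congr (_ - _ - _); apply/matrixP => i j; rewrite !mxE reg.
by rewrite -mulrnBl.
Qed.

Lemma det_scalar_sub_scale (F : fieldType) n (M : 'M[F]_n) s t : t != 0 ->
  \det (s%:M - t *: M) = t ^+ n * (char_poly M).[s / t].
Proof.
move=> t0; rewrite horner_char_poly -detZ scalerBr scale_scalar_mx.
by rewrite mulrC divfK.
Qed.

(* Its roots are the finitely many points where the Schur complement formula or
   the evaluation of the all-ones perturbation would divide by zero. *)
Definition exceptional (G H : sgraph) r : {poly algC} :=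
  ('X - 2%:P) * char_poly (signless_laplacian H + (#|G|%:R)%:M) *
  (('X - (#|H|%:R + r%:R)%:P) * ('X - 2%:P) - ((2 * r)%:R)%:P).

Lemma exceptional_neq0 G H r : exceptional G H r != 0.
Proof.
rewrite !mulf_neq0 ?polyXsubC_eq0 ?monic_neq0 ?char_poly_monic //.
(* The last factor is a monic quadratic minus a constant, hence monic. *)
apply/monicP; rewrite lead_coefDl; last first.
  rewrite size_polyN size_polyC size_mul ?polyXsubC_eq0 // !size_XsubC.
  by case: (_ != 0).
by rewrite lead_coefM !lead_coefXsubC mulr1.
Qed.

(** The factors of [exceptional] yield the conditions in turn. The last one is [a - 2] times the
    eigenvalue on the all-ones vector of the matrix that the coronal term perturbs; the shift by
    [#|G|] in the second turns [a] into [a - #|G|]. *)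
Lemma exceptionalP G H r a : (exceptional G H r).[a] != 0 ->
  [/\ a != 2, (char_poly (signless_laplacian H)).[a - #|G|%:R] != 0
    & a - #|H|%:R - r%:R - (a - 2)^-1 * (2 * r)%:R != 0].
Proof.
rewrite !hornerM !mulf_eq0 !negb_or => /andP [/andP [a2 chiH] mu].
rewrite hornerXsubC subr_eq0 in a2; split=> //.
  move: chiH; rewrite !horner_char_poly raddfB /=.
  by rewrite opprD addrA addrAC.
apply: contraNneq mu => mu0.
rewrite hornerD hornerN hornerM !hornerXsubC hornerC.
have -> : (a - (#|H|%:R + r%:R)) * (a - 2) - (2 * r)%:R =
  (a - 2) * (a - #|H|%:R - r%:R - (a - 2)^-1 * (2 * r)%:R).
  by field; rewrite subr_eq0.
by rewrite mu0 mulr0.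
Qed.

(** The all-ones vector is an eigenvector of the unperturbed matrix, so J splits off as a scalar
    factor. Then [G] enters only through [#|G|], [#|edge G|], [r] and its characteristic polynomial,
    which is what (a) compares. *)
Lemma char_poly_join_regular (G H : sgraph) r a (b := a - #|G|%:R)
    (s := a - #|H|%:R - r%:R) :
  (forall x : G, deg x = r) -> (exceptional G H r).[a] != 0 ->
  (char_poly (signless_laplacian (subdiv_vertex_join G H))).[a] =
  (a - 2) ^+ #|edge G| * (char_poly (signless_laplacian H)).[b] *
  ((a - 2)^-1 ^+ #|G| * (char_poly (signless_laplacian G)).[s / (a - 2)^-1] *
   (1 - coronal_at (signless_laplacian H) b / (s - (a - 2)^-1 * (2 * r)%:R)
        * #|G|%:R)).
Proof.
move=> reg /exceptionalP [a2 b0 mu0]; rewrite (char_poly_join reg) //; congr (_ * _).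
rewrite (det_sub_const_mx _ mu0); last first.
  rewrite mulmxBl mul_scalar_mx -scalemxAl (regular_signless_laplacian reg).
  by rewrite scalerA -scalerBl.
by rewrite det_scalar_sub_scale // invr_neq0 // subr_eq0.
Qed.

(** * Invariants read off the Q-spectrum, and the conclusion *)

Lemma Qcospectral_card (G H : sgraph) : Qcospectral G H -> #|G| = #|H|.
Proof.
move=> /same_spectrumP /(congr1 (fun p : {poly algC} => size p)).
by rewrite !size_char_poly => -[].
Qed.

(** Equal traces give equal degree sums; dividing by the common order gives the degree, and halving
    gives the number of edges. *)
Lemma Qcospectral_regular (G1 G2 : sgraph) r1 r2 :
  Qcospectral G1 G2 -> (forall x : G1, deg x = r1) -> (forall x : G2, deg x = r2) ->
  r1 = r2 /\ #|edge G1| = #|edge G2|.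
Proof.
move=> cosp reg1 reg2; have eqn := Qcospectral_card cosp.
have eqS : (\sum_(x : G1) deg x = \sum_(x : G2) deg x)%N.
  apply/eqP; rewrite -(eqr_nat algC) -!trace_signless_laplacian -eqr_opp.
  (* The trace is minus the subleading coefficient, which exists because the graphs are nonempty. *)
  rewrite -!char_poly_trace ?vertex_gt0 //.
  by move/same_spectrumP: cosp => ->; rewrite eqn.
split; last by move: eqS; rewrite !handshake => /eqP; rewrite eqn_pmul2r // => /eqP.
move: eqS; rewrite (eq_bigr _ (fun x _ => reg1 x)) (eq_bigr _ (fun x _ => reg2 x)).
rewrite !sum_nat_const eqn => /eqP; rewrite eqn_pmul2l ?vertex_gt0 //.
by move/eqP.
Qed.

Theorem corollary2p14 :
  (forall G1 G2 H : sgraph,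
     regular G1 -> regular G2 -> Qcospectral G1 G2 -> regular H ->
     Qcospectral (subdiv_vertex_join G1 H) (subdiv_vertex_join G2 H))
  /\
  (forall G H1 H2 : sgraph,
     regular G -> Qcospectral H1 H2 ->
     coronal (signless_laplacian H1) = coronal (signless_laplacian H2) ->
     Qcospectral (subdiv_vertex_join G H1) (subdiv_vertex_join G H2)).
Proof.
split=> [G1 G2 H [r1 reg1] [r2 reg2] cosp _|G H1 H2 [r reg] cosp eq_cor].
  have [eqr eqm] := Qcospectral_regular cosp reg1 reg2; subst r2.
  have eqn := Qcospectral_card cosp; move/same_spectrumP: cosp => eq_chi.
  (* [exceptional] sees its first graph only through its order, so one exceptional set serves both
     joins. *)
  have eq_exc : exceptional G2 H r1 = exceptional G1 H r1.
    by rewrite /exceptional eqn.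
  apply/same_spectrumP/(eq_poly_generic (exceptional_neq0 G1 H r1)) => a exc.
  rewrite (char_poly_join_regular reg1) // (char_poly_join_regular reg2) ?eq_exc //.
  by rewrite eq_chi eqn eqm.
have eqn := Qcospectral_card cosp; move/same_spectrumP: cosp => eq_chi.
apply/same_spectrumP/(eq_poly_generic (exceptional_neq0 G H1 r)) => a.
(* With equal orders and equal coronal values, the remaining determinants are those of one and the
   same matrix. *)
move=> /exceptionalP [a2 b0 _]; rewrite !(char_poly_join reg) -?eq_chi //.
by rewrite eq_chi (eq_coronal_at eq_chi eq_cor) // eqn.
Qed.
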